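(* Let $(\gamma_j)_{j\ge 1}$ be a sequence of reals with $1\ge\gamma_1\ge\gamma_2\ge\cdots\ge 0$, and consider the associated product weights $\gamma_{\mathfrak u}=\prod_{j\in\mathfrak u}\gamma_j$. Then: (1) The centered regular grid with different mesh-sizes achieves weak tractability (WT) for the $\boldsymbol\gamma$-weighted star discrepancy if and only if $\lim_{j\to\infty} j\gamma_j=0$. (2) The centered regular grid with different mesh-sizes achieves uniform weak tractability (UWT) for the $\boldsymbol\gamma$-weighted star discrepancy if and only if $\lim_{j\to\infty} j^n\gamma_j=0$ for all $n\in\mathbb N$.
   Context: For $d\in\mathbb N$ write $[d]=\{1,\dots,d\}$. For mesh-sizes $m_1,\dots,m_d\in\mathbb N$, the centered regular grid is $\Gamma_{m_1,\dots,m_d}=\{(\frac{2\ell_1+1}{2m_1},\dots,\frac{2\ell_d+1}{2m_d}) : \ell_j\in\{0,1,\dots,m_j-1\}\text{ for } j=1,\dots,d\}$, an $N$-point set with $N=m_1\cdots m_d$. For an $N$-point set $\mathcal P_d\subset[0,1)^d$ with real coefficients $\mathcal A(\mathcal P_d)=\{a_{\boldsymbol x}:\boldsymbol x\in\mathcal P_d\}$, the local discrepancy is $\Delta_{\mathcal P_d,\mathcal A(\mathcal P_d)}(\boldsymbol\alpha)=\sum_{\boldsymbol x\in\mathcal P_d}a_{\boldsymbol x}\mathbf 1_{[\boldsymbol 0,\boldsymbol\alpha)}(\boldsymbol x)-\prod_{j=1}^d\alpha_j$ for $\boldsymbol\alpha=(\alpha_1,\dots,\alpha_d)\in[0,1]^d$,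 where $[\boldsymbol 0,\boldsymbol\alpha)=[0,\alpha_1)\times\cdots\times[0,\alpha_d)$. Given weights $\gamma_{\mathfrak u}\in[0,1]$ for $\emptyset\ne\mathfrak u\subseteq[d]$, the $\boldsymbol\gamma$-weighted star discrepancy is $D^*_{N,\boldsymbol\gamma}(\mathcal P_d,\mathcal A(\mathcal P_d))=\sup_{\boldsymbol\alpha\in[0,1]^d}\max_{\emptyset\ne\mathfrak u\subseteq[d]}\gamma_{\mathfrak u}|\Delta_{\mathcal P_d,\mathcal A(\mathcal P_d)}((\boldsymbol\alpha_{\mathfrak u},\boldsymbol 1))|$, where $(\boldsymbol\alpha_{\mathfrak u},\boldsymbol 1)=(y_1,\dots,y_d)$ with $y_j=\alpha_j$ for $j\in\mathfrak u$ and $y_j=1$ otherwise. For $\varepsilon\in(0,1)$ and $d\in\mathbb N$ define $N_{\boldsymbol\gamma}(\varepsilon,d)=\min\{N\in\mathbb N: N=m_1\cdots m_d \text{ for some } m_1,\dots,m_d\in\mathbb N \text{ and there exist coefficients } \mathcal A(\Gamma_{m_1,\dots,m_d}) \text{ with } D^*_{N,\boldsymbol\gamma}(\Gamma_{m_1,\dots,m_d},\mathcal A(\Gamma_{m_1,\dots,m_d}))\le\varepsilon\}$. The centered regular grid with different mesh-sizes achieves WT if $\lim_{\varepsilon^{-1}+d\to\infty}\frac{\log N_{\boldsymbol\gamma}(\varepsilon,d)}{\varepsilon^{-1}+d}=0$, and UWT if $\lim_{\varepsilon^{-1}+d\to\infty}\frac{\log N_{\boldsymbol\gamma}(\varepsilon,d)}{\varepsilon^{-t_1}+d^{t_2}}=0$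 for all $t_1,t_2\in(0,1]$. *)

(* Defs.v *)
From HB Require Import structures.
From mathcomp Require Import all_boot all_order all_algebra.
From mathcomp Require Import all_classical all_reals all_analysis.
Set Implicit Arguments. Unset Strict Implicit. Unset Printing Implicit Defensive.
Import Order.TTheory GRing.Theory Num.Theory.
Local Open Scope classical_set_scope.
Local Open Scope ring_scope.

Section Defs.
Variable R : realType.

(* grid indices: l_j in {0,...,m_j - 1}, coordinate j : 'I_d stands for j+1 *)
Definition grid_index (d : nat) (m : 'I_d -> nat) : finType :=
  {dffun forall j : 'I_d, 'I_(m j)}.

Definition grid_pt (d : nat) (m : 'I_d -> nat) (l : grid_index m) (j : 'I_d) : R :=
  ((2 * l j + 1)%N)%:R / ((2 * m j)%N)%:R.

Definition local_disc (d : nat) (m : 'I_d -> nat) (a : grid_index m -> R)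
  (alpha : 'I_d -> R) : R :=
  \sum_(l : grid_index m)
     a l * (if [forall j, grid_pt l j < alpha j] then 1 else 0)
  - \prod_(j < d) alpha j.

Definition restr_one (d : nat) (u : {set 'I_d}) (alpha : 'I_d -> R) : 'I_d -> R :=
  fun j => if j \in u then alpha j else 1.

(* product weights gamma_u = prod_{j in u} gamma_j (gamma indexed from 1) *)
Definition prod_weight (gamma : nat -> R) (d : nat) (u : {set 'I_d}) : R :=
  \prod_(j in u) gamma j.+1.

Definition wstar_disc (gamma : nat -> R) (d : nat) (m : 'I_d -> nat)
  (a : grid_index m -> R) : R :=
  sup [set r : R | exists alpha : 'I_d -> R, exists u : {set 'I_d},
         (forall j, 0 <= alpha j <= 1) /\ u != finset.set0 /\
         r = prod_weight gamma u * `|local_disc a (restr_one u alpha)| ].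

Definition admissible (gamma : nat -> R) (eps : R) (d N : nat) : Prop :=
  exists m : 'I_d -> nat, (forall j, (0 < m j)%N) /\ N = (\prod_(j < d) m j)%N /\
    exists a : grid_index m -> R, wstar_disc gamma a <= eps.

(* N_gamma(eps, d) = min of admissible N (0 if there is none, which does not occur) *)
Definition Ngamma (gamma : nat -> R) (eps : R) (d : nat) : nat :=
  match pselect (exists N, (0 < N)%N /\ admissible gamma eps d N) with
  | left h => @ex_minn (fun N => `[< (0 < N)%N /\ admissible gamma eps d N >])
                (let: ex_intro N hN := h in ex_intro _ N (asboolT hN))
  | right _ => 0%N
  end.

Definition WT (gamma : nat -> R) : Prop :=
  forall eta : R, 0 < eta -> exists M : R, forall (eps : R) (d : nat),
    0 < eps < 1 -> (0 < d)%N -> M <= eps^-1 + d%:R ->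
    `| ln (Ngamma gamma eps d)%:R / (eps^-1 + d%:R) | <= eta.

Definition UWT (gamma : nat -> R) : Prop :=
  forall t1 t2 : R, 0 < t1 <= 1 -> 0 < t2 <= 1 ->
  forall eta : R, 0 < eta -> exists M : R, forall (eps : R) (d : nat),
    0 < eps < 1 -> (0 < d)%N -> M <= eps `^ (- t1) + d%:R `^ t2 ->
    `| ln (Ngamma gamma eps d)%:R / (eps `^ (- t1) + d%:R `^ t2) | <= eta.

End Defs.

(* Main.v *)
(** Upper bound on N(eps, d): use equal coefficients 1/N, for which the local
    discrepancy is a difference of products and is at most
    min(1, sum_(j in u) 1/(2 m_j)).  Coordinates with gamma_j <= eps get m_j = 1,
    because every u containing one has gamma_u <= eps; the others get
    m_j ~ C gamma_j / eps, which suffices since |v| gamma_v <= sup_j j gamma_j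
    for all v.  Hence log N(eps, d) is at most the sum of log(2 C gamma_j / eps)
    over the j with gamma_j > eps.  For WT this is o(1/eps) by log y <= 2 sqrt y
    and the bound 2 sqrt n for the partial sums of 1 / sqrt j; for UWT it is
    O(eps^(-t/2)) for every t > 0.

    Lower bound: if m_j = 1, the only node of coordinate j is 1/2, so u = {j} and
    alpha_j = 1/2 give gamma_j / 2 <= eps.  With eps = gamma_d / 3 all m_j with
    j <= d are therefore at least 2, and N(eps, d) >= 2^d. *)
Require Import Defs.
From HB Require Import structures.
From mathcomp Require Import all_boot all_order all_algebra.
From mathcomp Require Import all_classical all_reals all_analysis.
From mathcomp Require Import ring lra zify.
Import Order.TTheory GRing.Theory Num.Theory numFieldNormedType.Exports.
Local Open Scope classical_set_scope.
Local Open Scope ring_scope.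

(** * Local discrepancy of the grid with equal coefficients *)

Lemma sum_dffun_prod (R : comPzRingType) (I : finType) (T_ : I -> finType)
    (F : forall i, T_ i -> R) :
  \sum_(f : {dffun forall i, T_ i}) \prod_i F i (f i) = \prod_i \sum_(j : T_ i) F i j.
Proof.
(* Through [fprod], dependent functions become ordinary functions into a tagged sum, where the usual
   distributive law applies. *)
rewrite (reindex (@dffun_of_fprod I T_)); last first.
  exact/onW_bij/dffun_of_fprod_bij.
pose P i : {ffun T_ i -> R} := [ffun j => F i j].
transitivity (\sum_(t : fprod T_) \prod_(i in I) P i (t i)).
  by apply: eq_bigr => t _; apply: eq_bigr => i _; rewrite !ffunE.
rewrite big_fprod; apply: etrans (esym (@bigA_distr_big_dep R 0 1 *%R +%R I _
  (tagged_with T_) (fun i => untag 0 (P i)))) _.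
apply: eq_bigr => i _; rewrite -(@big_tag R 0 +%R I T_ (fun i => P i) i).
by apply: eq_bigr => j _; rewrite ffunE.
Qed.

(** Induction on [m]: if [y <= m], the new node [m + 1/2] is not counted. Otherwise all earlier
    nodes are, and the count is [m] or [m + 1] according to the side of [m + 1/2] on which [y]
    lies. *)
Lemma midpoint_count (R : realType) (m : nat) (y : R) : 0 <= y <= m%:R ->
  `|\sum_(i < m) (if i%:R + 2^-1 < y then 1 else 0) - y| <= 2^-1.
Proof.
elim: m => [|m IH] /andP[y0 ym].
  by rewrite big_ord0 (_ : y = 0) ?subrr ?normr0 //; apply/eqP; rewrite eq_le y0 ym.
rewrite big_ord_recr /=; case: (leP y m%:R) => ym'.
  by rewrite ifF ?addr0 ?IH ?y0 //; apply/negbTE; rewrite -leNgt; lra.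
rewrite (eq_bigr (fun _ => 1)) => [|i _]; last first.
  rewrite ifT //; have : (i.+1%:R : R) <= m%:R by rewrite ler_nat.
  by rewrite -natr1; lra.
rewrite sumr_const card_ord; rewrite -natr1 in ym; rewrite ler_norml.
by case: ltP => ?; apply/andP; split; lra.
Qed.

(** Empirical distribution function of the [m] midpoints of one coordinate. *)
Definition grid_cdf (R : realType) (m : nat) (x : R) : R :=
  m%:R^-1 * \sum_(i < m) (if ((2 * i + 1)%N)%:R / ((2 * m)%N)%:R < x then 1 else 0).

Lemma node_lt (R : realType) (m i : nat) (x : R) : (0 < m)%N ->
  (((2 * i + 1)%N)%:R / ((2 * m)%N)%:R < x) = (i%:R + 2^-1 < m%:R * x).
Proof.
move=> m0; have m0' : 0 < m%:R :> R by rewrite ltr0n.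
rewrite ltr_pdivrMr ?ltr0n ?muln_gt0 // natrD !natrM.
apply/idP/idP; lra.
Qed.

Lemma grid_cdf_dist (R : realType) (m : nat) (x : R) : (0 < m)%N -> 0 <= x <= 1 ->
  `|grid_cdf R m x - x| <= (2 * m%:R)^-1.
Proof.
move=> m0 /andP[x0 x1]; have m0' : 0 < m%:R :> R by rewrite ltr0n.
have h : 0 <= m%:R * x <= m%:R by rewrite mulr_ge0 ?ler0n // ler_piMr ?ler0n.
have := midpoint_count R m (m%:R * x) h.
under eq_bigr do rewrite -node_lt //.
rewrite /grid_cdf; set s := \sum_(_ < _) _ => {}h.
have -> : m%:R^-1 * s - x = m%:R^-1 * (s - m%:R * x).
  by rewrite mulrBr mulrA mulVf ?mul1r ?gt_eqF.
by rewrite normrM gtr0_norm ?invr_gt0 // invfM mulrC ler_pM2r ?invr_gt0.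
Qed.

Lemma grid_cdf_01 (R : realType) (m : nat) (x : R) : (0 < m)%N -> 0 <= grid_cdf R m x <= 1.
Proof.
move=> m0; have m0' : 0 < m%:R :> R by rewrite ltr0n.
rewrite /grid_cdf; apply/andP; split.
  by rewrite mulr_ge0 ?invr_ge0 ?ler0n ?sumr_ge0 // => i _; case: ifP.
rewrite mulrC ler_pdivrMr // mul1r -[leRHS](_ : \sum_(i < m) 1 = _).
  by apply: ler_sum => i _; case: ifP.
by rewrite sumr_const card_ord.
Qed.

Lemma grid_cdf_1 (R : realType) (m : nat) : (0 < m)%N -> grid_cdf R m 1 = 1.
Proof.
move=> m0; rewrite /grid_cdf (eq_bigr (fun _ => 1)) => [|i _].
  by rewrite sumr_const card_ord mulVf // pnatr_eq0 -lt0n.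
by rewrite ifT // ltr_pdivrMr ?ltr0n ?muln_gt0 // mul1r ltr_nat; have := ltn_ord i; lia.
Qed.

(** Factors are exchanged one at a time, the others being in [0,1]; the induction therefore carries
    the range of both partial products along with the estimate. *)
Lemma prod_dist (R : realType) (I : finType) (A B : I -> R) :
  (forall i, 0 <= A i <= 1) -> (forall i, 0 <= B i <= 1) ->
  `|\prod_i A i - \prod_i B i| <= \sum_i `|A i - B i|.
Proof.
move=> hA hB.
suff [] : 0 <= \prod_i A i <= 1 /\ 0 <= \prod_i B i <= 1 /\
   `|\prod_i A i - \prod_i B i| <= \sum_i `|A i - B i| by move=> _ [].
apply: (big_rec3 (fun a b c => 0 <= a <= 1 /\ 0 <= b <= 1 /\ `|a - b| <= c)).
  by rewrite !ler01 !lexx subrr normr0.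
move=> i a b c _ [/andP[a0 a1] [/andP[b0 b1] h]].
have /andP[A0 A1] := hA i; have /andP[B0 B1] := hB i.
rewrite !mulr_ge0 ?mulr_ile1 //; split => //; split => //.
have -> : A i * a - B i * b = (A i - B i) * a + B i * (a - b) by ring.
rewrite (le_trans (ler_normD _ _)) // !normrM lerD //.
  by rewrite (ger0_norm a0) ler_piMr.
by rewrite (ger0_norm B0) (le_trans _ h) // ler_piMl.
Qed.

(** The indicator of a box is a product of coordinate indicators, so the sum over the grid
    factors. *)
Lemma local_disc_uniform (R : realType) (d : nat) (m : 'I_d -> nat) (al : 'I_d -> R) :
  (forall j, (0 < m j)%N) ->
  local_disc (fun _ : grid_index m => \prod_j (m j)%:R^-1) al =
  \prod_j grid_cdf R (m j) (al j) - \prod_j al j.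
Proof.
move=> m0; rewrite /local_disc; congr (_ - _).
rewrite [RHS](eq_bigr (fun j => \sum_(i < m j) ((m j)%:R^-1 *
    (if ((2 * i + 1)%N)%:R / ((2 * m j)%N)%:R < al j then 1 else 0)))); last first.
  by move=> j _; rewrite -mulr_sumr.
rewrite -(@sum_dffun_prod R _ (fun j => 'I_(m j))
   (fun j i => ((m j)%:R^-1 * (if ((2 * i + 1)%N)%:R / ((2 * m j)%N)%:R < al j then 1 else 0)))).
apply: eq_bigr => l _; rewrite big_split /=; congr (_ * _).
case: forallP => [h|h].
  by rewrite big1 // => j _; rewrite -[_ / _]/(grid_pt R l j) h.
have [j hj] : exists j, ~~ (grid_pt R l j < al j).
  by apply/existsP; rewrite -negb_forall; apply/forallP.
by rewrite (bigD1 j) //= -[_ / _]/(grid_pt R l j) (negbTE hj) mul0r.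
Qed.

Lemma restr_one01 (R : realType) (d : nat) (u : {set 'I_d}) (al : 'I_d -> R) :
  (forall j, 0 <= al j <= 1) -> forall j, 0 <= restr_one u al j <= 1.
Proof. by move=> h j; rewrite /restr_one; case: ifP => // _; rewrite ler01 lexx. Qed.

(** Both products lie in [0,1], whence the bound 1. Coordinates outside [u] are evaluated at 1,
    where [grid_cdf] is exact, so only those in [u] contribute to the sum. *)
Lemma local_disc_uniform_le (R : realType) (d : nat) (m : 'I_d -> nat)
    (u : {set 'I_d}) (al : 'I_d -> R) :
  (forall j, (0 < m j)%N) -> (forall j, 0 <= al j <= 1) ->
  `|local_disc (fun _ : grid_index m => \prod_j (m j)%:R^-1) (restr_one u al)|
    <= Num.min 1 (\sum_(j in u) (2 * (m j)%:R)^-1).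
Proof.
move=> m0 hal; have hr := restr_one01 R d u al hal.
rewrite local_disc_uniform // le_min; apply/andP; split.
  have p01 (f : 'I_d -> R) : (forall j, 0 <= f j <= 1) -> 0 <= \prod_j f j <= 1.
    by move=> hf; rewrite prodr_ge0 ?Num.Theory.prodr_ile1 // => j _; case/andP: (hf j).
  have /andP[a0 a1] := p01 _ (fun j => grid_cdf_01 R _ (restr_one u al j) (m0 j)).
  have /andP[b0 b1] := p01 _ hr.
  by rewrite ler_norml; apply/andP; split; lra.
apply: (le_trans (prod_dist _ _ _ _ _ _)) => // [j|]; first exact: grid_cdf_01.
rewrite [leRHS]big_mkcond; apply: ler_sum => j _; case: ifP => ju.
  exact: grid_cdf_dist.
by rewrite /restr_one ju grid_cdf_1 // subrr normr0.
Qed.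

(** * Product weights and the weighted star discrepancy *)

Lemma prod_weight_ge0 (R : realType) (gamma : nat -> R) (d : nat) (u : {set 'I_d}) :
  (forall j, (1 <= j)%N -> 0 <= gamma j <= 1) -> 0 <= prod_weight gamma u.
Proof. by move=> h; rewrite prodr_ge0 // => j _; have /andP[] := h j.+1 isT. Qed.

Lemma prod_weight_le (R : realType) (gamma : nat -> R) (d : nat) (u : {set 'I_d}) j :
  (forall j, (1 <= j)%N -> 0 <= gamma j <= 1) -> j \in u ->
  prod_weight gamma u <= gamma j.+1.
Proof.
move=> h ju; rewrite /prod_weight (bigD1 j) //= ler_piMr ?Num.Theory.prodr_ile1 //.
  by have /andP[] := h j.+1 isT.
by move=> i _; exact: h.
Qed.

Lemma wstar_disc_le (R : realType) (gamma : nat -> R) (d : nat) (m : 'I_d -> nat)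
    (a : grid_index m -> R) (e : R) : (0 < d)%N ->
  (forall (al : 'I_d -> R) (u : {set 'I_d}), (forall j, 0 <= al j <= 1) ->
     u != finset.set0 -> prod_weight gamma u * `|local_disc a (restr_one u al)| <= e) ->
  wstar_disc gamma a <= e.
Proof.
move=> d0 h; apply: ge_sup; last by move=> _ [al [u [hal [hu ->]]]]; exact: h.
(* The supremum needs a nonempty set; [0 < d] makes the full index set a legitimate [u]. *)
exists (prod_weight gamma (finset.setT : {set 'I_d})
          * `|local_disc a (restr_one finset.setT (fun _ => 0))|).
exists (fun _ => 0), finset.setT; split; first by move=> j; rewrite lexx ler01.
by split=> //; apply/set0Pn; exists (Ordinal d0); rewrite inE.
Qed.

Lemma le_wstar_disc (R : realType) (gamma : nat -> R) (d : nat) (m : 'I_d -> nat)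
    (a : grid_index m -> R) (al : 'I_d -> R) (u : {set 'I_d}) :
  (forall j, (1 <= j)%N -> 0 <= gamma j <= 1) ->
  (forall j, 0 <= al j <= 1) -> u != finset.set0 ->
  prod_weight gamma u * `|local_disc a (restr_one u al)| <= wstar_disc gamma a.
Proof.
move=> hg hal hu; apply: sup_upper_bound; last by exists al, u.
split; first by eexists; exists al, u.
(* A bound uniform in the box and in [u]: the indicators, the volume and the weight are all at most
   1. *)
exists (\sum_l `|a l| + 1) => _ [be [v [hbe [hv ->]]]].
have hr := restr_one01 R d v be hbe.
have w1 : prod_weight gamma v <= 1.
  by rewrite Num.Theory.prodr_ile1 // => j _; exact: hg.
apply: (@le_trans _ _ `|local_disc a (restr_one v be)|).
  by rewrite ler_piMl.
rewrite (le_trans (ler_normB _ _)) // lerD //.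
  rewrite (le_trans (ler_norm_sum _ _ _)) //; apply: ler_sum => l _.
  by case: ifP => _; rewrite ?mulr1 // mulr0 normr0.
rewrite ger0_norm ?Num.Theory.prodr_ile1 // prodr_ge0 // => j _.
by have /andP[] := hr j.
Qed.

(** * The minimal [N] and its upper bound *)

Lemma Ngamma_min (R : realType) (gamma : nat -> R) (e : R) (d N : nat) :
  (0 < N)%N -> admissible gamma e d N ->
  [/\ (0 < Ngamma gamma e d)%N, admissible gamma e d (Ngamma gamma e d)
    & (Ngamma gamma e d <= N)%N].
Proof.
move=> N0 hN; rewrite /Ngamma; case: pselect => [h|[]]; last by exists N.
case: ex_minnP => n /asboolP[n0 hn] hmin; split => //.
by apply: hmin; apply/asboolP.
Qed.

(** By pigeonhole, a set of k indices contains some [i] with [i.+1 >= k], and the single factor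
    [gamma i.+1] already bounds the weight. *)
Lemma card_weight_le (R : realType) (gamma : nat -> R) (d : nat) (C : R) (v : {set 'I_d}) :
  (forall j, (1 <= j)%N -> 0 <= gamma j <= 1) ->
  0 <= C -> (forall j, (j < d)%N -> j.+1%:R * gamma j.+1 <= C) ->
  #|v|%:R * prod_weight gamma v <= C.
Proof.
move=> hg C0 hC; have [->|v0] := eqVneq v finset.set0.
  by rewrite cards0 mul0r.
have [i iv hi] : exists2 i, i \in v & (#|v| <= i.+1)%N.
  apply/exists_inP; rewrite -[X in is_true X]negbK negb_exists_in.
  apply/negP => /forall_inP h.
  have v0' : (0 < #|v|)%N by rewrite card_gt0.
  have hd : (#|v|.-1 <= d)%N.
    by rewrite (leq_trans (leq_pred _)) // -[leqRHS](card_ord d) max_card.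
  have : v \subset [set widen_ord hd k | k in 'I_(#|v|.-1)]%SET.
    apply/fintype.subsetP => i iv; have := h i iv; rewrite -ltnNge => hi.
    have hi' : (i < #|v|.-1)%N by rewrite -ltnS prednK.
    by apply/imsetP; exists (Ordinal hi') => //; apply: val_inj.
  move=> /subset_leq_card; rewrite leqNgt => /negP; apply.
  by rewrite (leq_ltn_trans (leq_imset_card _ _)) // card_ord prednK.
rewrite (le_trans _ (hC i (ltn_ord i))) //.
by rewrite ler_pM ?ler0n ?ler_nat ?prod_weight_ge0 ?prod_weight_le.
Qed.

Definition mesh (R : realType) (gamma : nat -> R) (C e : R) (j : nat) : nat :=
  if e < gamma j.+1 then (Num.truncn (C * gamma j.+1 / e)).+1 else 1%N.

Lemma mesh_gt0 (R : realType) (gamma : nat -> R) (C e : R) (j : nat) :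
  (0 < mesh R gamma C e j)%N.
Proof. by rewrite /mesh; case: ifP. Qed.

(** If all weights in [u] exceed [e], each coordinate gets a share [e / #|u|] of the error:
    [gamma j.+1] cancels against the mesh, leaving [e / C] times the weight of [u :\ j]. The bound
    [C - 1] leaves room for the removed index, since [#|u|] is one more than the size of
    [u :\ j]. *)
Lemma mesh_admissible (R : realType) (gamma : nat -> R) (C e : R) (d : nat) :
  (forall j, (1 <= j)%N -> 0 <= gamma j <= 1) ->
  1 <= C -> (forall j, (j < d)%N -> j.+1%:R * gamma j.+1 <= C - 1) ->
  0 < e -> (0 < d)%N ->
  admissible gamma e d (\prod_(j < d) mesh R gamma C e j).
Proof.
move=> hg C1 hC e0 d0; exists (fun j : 'I_d => mesh R gamma C e j).
split; first by move=> j; exact: mesh_gt0.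
split=> //; exists (fun=> \prod_(j < d) (mesh R gamma C e j)%:R^-1).
apply: wstar_disc_le => // al u hal u0.
have := local_disc_uniform_le R d _ u al (fun j : 'I_d => mesh_gt0 R gamma C e j) hal.
rewrite le_min => /andP[h1 h2].
have w0 := prod_weight_ge0 R gamma d u hg.
have [/exists_inP[j ju hj]|] := boolP [exists j in u, gamma j.+1 <= e].
  apply: (le_trans _ hj); rewrite -[leRHS]mulr1 ler_pM //.
  exact: prod_weight_le.
rewrite negb_exists_in => /forall_inP hu.
apply: (le_trans (ler_wpM2l w0 h2)).
rewrite mulr_sumr.
have C0 : 0 < C by lra.
apply: (@le_trans _ _ (\sum_(j in u) (e / C * (C / #|u|%:R)))); last first.
  have u0' : #|u|%:R != 0 :> R by rewrite pnatr_eq0 -lt0n card_gt0.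
  rewrite sumr_const -[leLHS]mulr_natr le_eqVlt; apply/orP; left; apply/eqP.
  by field; rewrite u0' gt_eqF.
apply: ler_sum => j ju; have := hu j ju; rewrite -ltNge => hj.
have g0 : 0 < gamma j.+1 by exact: lt_trans hj.
have hm : C * gamma j.+1 / e <= 2 * (mesh R gamma C e j)%:R.
  rewrite /mesh hj (le_trans (ltW (truncnS_gt _))) //.
  by rewrite ler_peMl // ler1n.
have hw : #|u|%:R * prod_weight gamma (u :\ j) <= C.
  rewrite (cardsD1 j) ju natrD mulrDl mul1r.
  have := card_weight_le R gamma d (C - 1) (u :\ j) hg _ hC; rewrite subr_ge0.
  move=> /(_ C1); have : prod_weight gamma (u :\ j) <= 1.
    by rewrite Num.Theory.prodr_ile1 // => i _; exact: hg.
  by lra.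
have -> : prod_weight gamma u = gamma j.+1 * prod_weight gamma (u :\ j).
  rewrite /prod_weight (bigD1 j) //=; congr (_ * _); apply: eq_bigl => i.
  by rewrite !inE andbC.
have hi : (2 * (mesh R gamma C e j)%:R)^-1 <= e / (C * gamma j.+1).
  rewrite -[leRHS]invrK lef_pV2 ?posrE ?invf_div //.
    by rewrite mulr_gt0 ?ltr0n ?mesh_gt0.
  by rewrite divr_gt0 // mulr_gt0.
apply: (le_trans (ler_wpM2l _ hi)).
  by rewrite (mulr_ge0 (ltW g0)) ?prod_weight_ge0.
have -> : gamma j.+1 * prod_weight gamma (u :\ j) * (e / (C * gamma j.+1))
   = e / C * prod_weight gamma (u :\ j) by field; rewrite !gt_eqF.
rewrite ler_pM2l ?divr_gt0 // ler_pdivlMr ?ltr0n ?card_gt0 //.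
by rewrite mulrC.
Qed.

Lemma ln_prod_natr (R : realType) (d : nat) (m : nat -> nat) :
  (forall j, (0 < m j)%N) ->
  ln (\prod_(j < d) m j)%:R = \sum_(j < d) ln (m j)%:R :> R.
Proof.
move=> m0; elim: d => [|d IH]; first by rewrite !big_ord0 ln1.
rewrite !big_ord_recr /= natrM lnM ?posrE ?ltr0n ?prodn_gt0 ?IH //.
Qed.

Lemma ln_Ngamma_ge0 (R : realType) (gamma : nat -> R) (e : R) (d : nat) :
  0 <= ln (Ngamma gamma e d)%:R :> R.
Proof. by case: (Ngamma _ _ _) => [|n]; [rewrite ln0 | rewrite ln_ge0 // ler1n]. Qed.

Lemma ln_Ngamma_le (R : realType) (gamma : nat -> R) (C e : R) (d : nat) :
  (forall j, (1 <= j)%N -> 0 <= gamma j <= 1) ->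
  1 <= C -> (forall j, (j < d)%N -> j.+1%:R * gamma j.+1 <= C - 1) ->
  0 < e -> (0 < d)%N ->
  ln (Ngamma gamma e d)%:R
    <= \sum_(j < d) (if e < gamma j.+1 then ln (2 * C * gamma j.+1 / e) else 0).
Proof.
move=> hg C1 hC e0 d0.
have hm0 j := mesh_gt0 R gamma C e j.
have [N0 _ hN] := Ngamma_min _ _ _ _ _ (prodn_gt0 (fun j : 'I_d => hm0 j))
  (mesh_admissible R gamma C e d hg C1 hC e0 d0).
apply: (@le_trans _ _ (ln (\prod_(j < d) mesh R gamma C e j)%:R)).
  by rewrite ler_ln ?posrE ?ltr0n ?prodn_gt0 // ler_nat.
rewrite (ln_prod_natr R d (mesh R gamma C e)) //; apply: ler_sum => j _.
rewrite /mesh; case: ifP => hj; last by rewrite ln1.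
(* Since this quotient is at least 1, its truncation plus 1 is at most twice the quotient; this is
   the factor 2 in the logarithm. *)
have h1 : 1 <= C * gamma j.+1 / e.
  by rewrite ler_pdivlMr // mul1r (le_trans (ltW hj)) // ler_peMl //; lra.
have h0 : 0 < C * gamma j.+1 / e by exact: lt_le_trans h1.
have h2 : 2 * C * gamma j.+1 / e = 2 * (C * gamma j.+1 / e) by rewrite !mulrA.
rewrite h2 ler_ln ?posrE ?ltr0n //; last by rewrite mulr_gt0.
have /andP[h3 _] := truncn_itv (ltW h0).
by rewrite -natr1; lra.
Qed.

(** * Lower bound on [N] and necessity of the decay *)

Lemma mesh1_weight_le (R : realType) (gamma : nat -> R) (d : nat) (m : 'I_d -> nat)
    (a : grid_index m -> R) (j : 'I_d) :
  (forall j, (1 <= j)%N -> 0 <= gamma j <= 1) ->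
  m j = 1%N -> gamma j.+1 <= 2 * wstar_disc gamma a.
Proof.
move=> hg mj.
have := le_wstar_disc R gamma d m a (fun=> 2^-1) (finset.set1 j) hg.
have -> : prod_weight gamma (finset.set1 j) = gamma j.+1 by rewrite /prod_weight big_set1.
(* The box is open at 1/2, so it misses every node whatever the coefficients; only its volume 1/2
   remains. *)
have -> : local_disc a (restr_one (finset.set1 j) (fun=> 2^-1)) = - 2^-1.
  rewrite /local_disc big1 => [|l _].
    rewrite sub0r (bigD1 j) //= big1 => [|i ij]; last by rewrite /restr_one inE (negbTE ij).
    by rewrite mulr1 /restr_one inE eqxx.
  rewrite ifF ?mulr0 //; apply/negbTE/negP => /forallP/(_ j).
  have lj : (l j : nat) = 0%N by have := ltn_ord (l j); rewrite {2}mj ltnS leqn0 => /eqP.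
  by rewrite /grid_pt lj mj /restr_one inE eqxx muln0 mul1r ltxx.
have half0 : 0 <= 2^-1 :> R by rewrite invr_ge0.
rewrite normrN (ger0_norm half0) => h; rewrite mulrC -ler_pdivrMr //.
by apply: h => [i|]; [rewrite half0 invf_le1 // ler1n | apply/set0Pn; exists j; rewrite inE].
Qed.

Lemma Ngamma_ge (R : realType) (gamma : nat -> R) (e : R) (d : nat) :
  (forall j, (1 <= j)%N -> 0 <= gamma j <= 1) ->
  (forall j, (1 <= j)%N -> gamma j.+1 <= gamma j) ->
  (0 < d)%N -> 0 < e -> 2 * e < gamma d -> (2 ^ d <= Ngamma gamma e d)%N.
Proof.
move=> hg hmono d0 e0 he.
(* Some admissible [N] must be exhibited to exclude the default value 0 of [Ngamma];
   [j gamma_j <= d] for [j <= d] permits the constant [d + 1]. *)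
have [_ [m [m0 [-> [a ha]]]] _] : [/\ (0 < Ngamma gamma e d)%N,
    admissible gamma e d (Ngamma gamma e d)
    & (Ngamma gamma e d <= \prod_(j < d) mesh R gamma (d%:R + 1) e j)%N].
  apply: Ngamma_min; first by apply: prodn_gt0 => j; exact: mesh_gt0.
  apply: mesh_admissible => // [|j jd]; first by rewrite lerDr.
  rewrite addrK -[leRHS]mulr1 ler_pM ?ler_nat //.
  - by have /andP[] := hg j.+1 isT.
  - by have /andP[] := hg j.+1 isT.
have hm (j k : nat) : (1 <= j)%N -> gamma (j + k)%N <= gamma j.
  move=> j1; elim: k => [|k IH]; first by rewrite addn0.
  by rewrite addnS (le_trans (hmono _ _)) // (leq_trans j1) // leq_addr.
rewrite -{1}(card_ord d) -prod_nat_const; apply: leq_prod => j _.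
rewrite leqNgt; apply/negP; rewrite ltnS => mj.
have {}mj : m j = 1%N by apply/eqP; rewrite eqn_leq mj m0.
have h1 := mesh1_weight_le R gamma d m a j hg mj.
have := hm j.+1 (d - j.+1)%N isT; rewrite subnKC // => h2.
by lra.
Qed.

(** Serves both WT and UWT. If [d ^ n * gamma d > del] for a large [d], then [e = gamma d / 3] makes
    the denominator at most [(K + 1) * d], while [ln N >= d * ln 2], so the quotient cannot be
    small. *)
Lemma decay_of_tractable (R : realType) (gamma : nat -> R) (t : R) (n : nat) :
  (forall j, (1 <= j)%N -> 0 <= gamma j <= 1) ->
  (forall j, (1 <= j)%N -> gamma j.+1 <= gamma j) ->
  0 < t <= 1 -> n%:R * t <= 1 ->
  (forall eta : R, 0 < eta -> exists M : R, forall (eps : R) (d : nat),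
    0 < eps < 1 -> (0 < d)%N -> M <= eps `^ (- t) + d%:R ->
    `| ln (Ngamma gamma eps d)%:R / (eps `^ (- t) + d%:R) | <= eta) ->
  (fun j : nat => j%:R ^+ n * gamma j) @ \oo --> 0%R.
Proof.
move=> hg hmono /andP[t0 t1] nt H; apply/cvgr0Pnorm_le => del del0.
(* [3 / del] comes from [1 / e = 3 / gamma d]; the added 1 gives [K >= 1], hence [K ^ t <= K].
   Below, [eta] is half of the ratio [ln 2 / (K + 1)]. *)
pose K := 3 / del + 1.
have K1 : 1 <= K by rewrite /K lerDr divr_ge0 // ltW.
have l2 : 0 < ln 2 :> R by rewrite ln_gt0 // ltr1n.
pose eta := ln 2 / (2 * (K + 1)).
have eta0 : 0 < eta by rewrite divr_gt0 // mulr_gt0 //; lra.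
have [M HM] := H eta eta0.
near=> d.
have d0 : (0 < d)%N by near: d; exact: nbhs_infty_ge.
have dM : M <= d%:R by near: d; exact: nbhs_infty_ger.
have /andP[g0 g1] := hg d d0.
have d1 : 1 <= d%:R :> R by rewrite ler1n.
have d0' : 0 < d%:R :> R by rewrite ltr0n.
rewrite ger0_norm ?mulr_ge0 ?exprn_ge0 // leNgt; apply/negP => hd.
have {}g0 : 0 < gamma d.
  rewrite lt_neqAle g0 andbT; apply/eqP => gd.
  by move: hd; rewrite -gd mulr0 ltNge ltW.
pose e := gamma d / 3.
(* [n t <= 1] makes [(d^n)^t <= d], so [e^(-t)] is at most linear in [d]. *)
have e0 : 0 < e by rewrite divr_gt0.
have he : e `^ (- t) <= K * d%:R.
  have -> : e `^ (- t) = e^-1 `^ t by rewrite -mulN1r powRrM powR_inv1 ?ltW.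
  apply: (@le_trans _ _ ((K * d%:R ^+ n) `^ t)).
    rewrite ge0_ler_powR ?nnegrE ?(ltW t0) ?invr_ge0 ?(ltW e0) //.
      by rewrite mulr_ge0 ?exprn_ge0 //; lra.
    rewrite invf_div ler_pdivrMr // -mulrA /K mulrDl mul1r.
    have : 3 = 3 / del * del by rewrite divfK ?gt_eqF.
    have : 3 / del * del <= 3 / del * (d%:R ^+ n * gamma d).
      by rewrite ler_wpM2l ?divr_ge0 ?ltW.
    have : 0 <= d%:R ^+ n * gamma d by rewrite mulr_ge0 ?exprn_ge0 ?ltW.
    by lra.
  rewrite powRM ?exprn_ge0 //; last by lra.
  rewrite ler_pM ?powR_ge0 //.
    by rewrite -[leRHS]powRr1 ?ler_powR //; lra.
  by rewrite -powR_mulrn // -powRrM -[leRHS]powRr1 ?ler_powR.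
have := HM e d; rewrite e0 d0 (_ : e < 1) /=; last by rewrite /e; lra.
have hp := powR_ge0 e (- t).
have s0 : 0 < e `^ (- t) + d%:R by lra.
move=> /(_ isT isT) HH.
have {HH} : `|ln (Ngamma gamma e d)%:R / (e `^ (- t) + d%:R)| <= eta.
  by apply: HH; lra.
apply/negP; rewrite -ltNge ger0_norm ?divr_ge0 ?ln_Ngamma_ge0 ?ltW //.
rewrite ltr_pdivlMr //.
have hN : (2 ^ d <= Ngamma gamma e d)%N.
  by apply: Ngamma_ge => //; rewrite /e; lra.
have hln : d%:R * ln 2 <= ln (Ngamma gamma e d)%:R :> R.
  rewrite mulr_natl -lnXn // -natrX ler_ln ?posrE ?ltr0n ?expn_gt0 ?ler_nat //.
  by rewrite (leq_trans _ hN) // expn_gt0.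
apply: (lt_le_trans _ hln).
apply: (@le_lt_trans _ _ (eta * ((K + 1) * d%:R))).
  by rewrite (ler_wpM2l (ltW eta0)) //; lra.
have -> : eta * ((K + 1) * d%:R) = d%:R * ln 2 / 2.
  by rewrite /eta; field; apply: lt0r_neq0; lra.
have : 0 < d%:R * ln 2 :> R by rewrite mulr_gt0.
by lra.
Unshelve. all: by end_near.
Qed.

(** * Sufficiency of the decay *)

Lemma sum_cut_le (R : numDomainType) (f : nat -> R) (b : nat -> bool) (B : R) (d : nat) :
  0 <= B -> (forall j, 0 <= f j) ->
  (forall n, b n -> \sum_(j < n.+1) f j <= B) ->
  \sum_(j < d) (if b j then f j else 0) <= B.
Proof.
(* Only the last index satisfying [b] matters: up to it, the cut sum is dominated by the full
   partial sum. *)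
move=> B0 f0 hB; elim: d => [|d IH]; first by rewrite big_ord0.
rewrite big_ord_recr /=; case: ifP => [bd|_]; last by rewrite addr0.
apply: le_trans (hB d bd); rewrite big_ord_recr /= lerD2r.
by apply: ler_sum => j _; case: ifP.
Qed.

(** With [a] and [b] the roots of n and n + 1, each step is [1 / b <= 2 * (b - a)]; as
    [b ^+ 2 - a ^+ 2 = 1], this amounts to [(a - b) ^+ 2 >= 0]. *)
Lemma sum_inv_sqrt_le (R : rcfType) (n : nat) :
  \sum_(j < n) (Num.sqrt (j.+1%:R : R))^-1 <= 2 * Num.sqrt n%:R.
Proof.
elim: n => [|n IH]; first by rewrite big_ord0 sqrtr0 mulr0.
rewrite big_ord_recr /= -lerBrDr (le_trans IH) // lerBrDr.
set a := Num.sqrt n%:R; set b := Num.sqrt n.+1%:R.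
have a0 : 0 <= a by exact: sqrtr_ge0.
have b0 : 0 < b by rewrite sqrtr_gt0 ltr0n.
have a2 : a ^+ 2 = n%:R by rewrite sqr_sqrtr ?ler0n.
have b2 : b ^+ 2 = n%:R + 1 by rewrite sqr_sqrtr ?ler0n // natr1.
rewrite -(ler_pM2r b0) mulrDl mulVf ?gt_eqF //.
by have := sqr_ge0 (a - b); rewrite sqrrB; lra.
Qed.

(** This is [ln z <= z] at [z = y ^ s]. *)
Lemma ln_le_powR (R : realType) (s y : R) : 0 < s -> 0 < y -> ln y <= s^-1 * y `^ s.
Proof.
move=> s0 y0; rewrite mulrC ler_pdivlMr // mulrC -ln_powR.
by apply/ltW/ln_sublinear; rewrite powR_gt0.
Qed.

Lemma cvg0_le (R : realType) (u : nat -> R) :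
  u @ \oo --> 0 -> exists2 C : R, 0 <= C & forall j, u j <= C.
Proof.
move=> hu; have /cvg_seq_bounded [M [_ hM]] : cvgn u by apply/cvg_ex; exists 0.
exists (`|M| + 1) => [|j]; first by rewrite addr_ge0.
apply: le_trans (ler_norm _) _; apply: hM => //=.
by rewrite (le_lt_trans (ler_norm _)) // ltrDl.
Qed.

Lemma WT_of_decay (R : realType) (gamma : nat -> R) :
  (forall j, (1 <= j)%N -> 0 <= gamma j <= 1) ->
  (fun j : nat => j%:R * gamma j) @ \oo --> 0%R -> WT gamma.
Proof.
move=> hg hu eta eta0.
have [C0 C00 hC] := cvg0_le _ _ hu.
pose C := C0 + 1.
have [c cE c0] : exists2 c, c = 2 * Num.sqrt (2 * C) & 0 < c.
  by exists (2 * Num.sqrt (2 * C)); rewrite // mulr_gt0 // sqrtr_gt0 /C; lra.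
(* Three terms [c * del / e] will occur, two from the tail and one from AM-GM; each equals
   [eta / (6 * e)]. The threshold [2 * B / eta] below lets the constant [B] take the other half of
   the target. *)
have [del delE del0] : exists2 del, del = eta / (6 * c) & 0 < del.
  by exists (eta / (6 * c)); rewrite // divr_gt0 // mulr_gt0.
move/cvgr0Pnorm_le : hu => /(_ del del0) [J _ hJ].
pose B := c * (J%:R ^+ 2 / (4 * del)).
exists (2 * B / eta) => e d /andP[e0 e1] d0 hM.
have dge0 : 0 < d%:R :> R by rewrite ltr0n.
have ie0 : 0 < e^-1 by rewrite invr_gt0.
have S0 : 0 < e^-1 + d%:R by lra.
rewrite ger0_norm ?divr_ge0 ?ln_Ngamma_ge0 ?(ltW S0) // ler_pdivrMr //.
pose s := Num.sqrt e^-1.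
have s0 : 0 <= s by exact: sqrtr_ge0.
have s2 : s ^+ 2 = e^-1 by rewrite sqr_sqrtr ?ltW.
suff hsum : ln (Ngamma gamma e d)%:R <= c * (J%:R * s) + 2 * c * del * s ^+ 2.
  (* AM-GM: [J s <= del s^2 + J^2 / (4 del)] *)
  have amgm : J%:R * s <= del * s ^+ 2 + J%:R ^+ 2 / (4 * del).
    rewrite -subr_ge0.
    have -> : del * s ^+ 2 + J%:R ^+ 2 / (4 * del) - J%:R * s =
       del * (s - J%:R / (2 * del)) ^+ 2 by field; rewrite gt_eqF.
    by rewrite mulr_ge0 ?sqr_ge0 ?ltW.
  have h1 : c * (J%:R * s) <= c * (del * s ^+ 2) + B.
    by rewrite -mulrDr ler_wpM2l // ltW.
  have h2 : c * (del * s ^+ 2) = eta / 6 * e^-1.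
    by rewrite s2 delE; field; rewrite !gt_eqF.
  have h3 : 2 * B <= (e^-1 + d%:R) * eta by rewrite -ler_pdivrMr.
  have h4 : 0 <= d%:R * eta by rewrite mulr_ge0 // ltW.
  apply: (le_trans hsum).
  have -> : 2 * c * del * s ^+ 2 = 2 * (c * (del * s ^+ 2)) by rewrite !mulrA.
  rewrite h2 in h1 *; lra.
apply: (le_trans (ln_Ngamma_le R gamma C e d hg _ _ e0 d0)).
- by rewrite /C; lra.
- by move=> j _; rewrite /C addrK.
have hterm j : e < gamma j.+1 ->
    ln (2 * C * gamma j.+1 / e) <= c * (Num.sqrt (gamma j.+1) * s).
  move=> hj; have g0 := lt_trans e0 hj.
  have C2 : 0 < 2 * C by rewrite mulr_gt0 // /C; lra.
  apply: le_trans (ln_le_powR _ 2^-1 _ _ _) _; first by rewrite invr_gt0.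
    by rewrite divr_gt0 // mulr_gt0.
  rewrite invrK powR12_sqrt; last by rewrite divr_ge0 ?ltW // mulr_gt0.
  have q0 : 0 <= 2 * C * gamma j.+1 by rewrite mulr_ge0 // ltW.
  by rewrite (sqrtrM _ q0) (sqrtrM _ (ltW C2)) cE /s !mulrA.
(* Majorants of the terms: [f1] uses [gamma <= 1] on the first [J] coordinates, [f2] uses
   [gamma j.+1 <= del / j.+1] on the rest. *)
pose f1 (j : nat) := c * s.
pose f2 (j : nat) := c * Num.sqrt del * s * (Num.sqrt j.+1%:R)^-1.
apply: (@le_trans _ _ (\sum_(j < d) (if (j < J)%N then f1 j else 0)
   + \sum_(j < d) (if (e < gamma j.+1) && (J <= j)%N then f2 j else 0))).
  rewrite -big_split /=; apply: ler_sum => j _.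
  case: ifP => hj; rewrite ?andbF /=; last first.
    by rewrite addr0; case: ifP => // _; rewrite /f1 mulr_ge0 // ltW.
  have g1 : gamma j.+1 <= 1 by have /andP[] := hg j.+1 isT.
  apply: (le_trans (hterm j hj)); rewrite [(J <= j)%N]leqNgt; case: ifP => jJ /=.
    rewrite addr0 /f1 ler_pM2l // ler_piMl // -sqrtr1 ler_wsqrtr //.
  have := hJ j.+1; rewrite /= ger0_norm; last first.
    by rewrite mulr_ge0 // ltW // (lt_trans e0).
  move=> /(_ _) hJj; rewrite add0r.
  have -> : f2 j = c * (Num.sqrt del / Num.sqrt j.+1%:R * s) by rewrite /f2; ring.
  rewrite ler_pM2l // ler_wpM2r // ler_pdivlMr ?sqrtr_gt0 ?ltr0n //.
  rewrite -sqrtrM; last by rewrite ltW // (lt_trans e0).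
  apply: ler_wsqrtr; rewrite mulrC; apply: hJj.
  by rewrite ltnW // ltnS leqNgt jJ.
apply: lerD.
  apply: (sum_cut_le _ f1 (fun j => j < J)%N).
  - by rewrite !mulr_ge0 // ltW.
  - by move=> j; rewrite /f1 mulr_ge0 // ltW.
  move=> n nJ; rewrite /f1 sumr_const card_ord mulrCA mulr_natl.
  by apply: ler_wpMn2l nJ; rewrite mulr_ge0 // ltW.
apply: (sum_cut_le _ f2 (fun j => (e < gamma j.+1) && (J <= j)%N)).
- by rewrite !mulr_ge0 ?exprn_ge0 ?(ltW c0) ?(ltW del0).
- by move=> j; rewrite /f2 !mulr_ge0 ?invr_ge0 ?sqrtr_ge0 // ltW.
move=> n /andP[hn Jn]; rewrite -mulr_sumr.
(* The cut limits the tail: [e < gamma n.+1 <= del / n.+1] forces [n.+1 <= del / e]. *)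
apply: (@le_trans _ _ (c * Num.sqrt del * s * (2 * (Num.sqrt del * s)))).
  apply: ler_wpM2l; first by rewrite !mulr_ge0 ?sqrtr_ge0 // ltW.
  apply: le_trans (sum_inv_sqrt_le _ _) _; rewrite ler_wpM2l //.
  rewrite -sqrtrM ?(ltW del0) //; apply: ler_wsqrtr.
  rewrite ler_pdivlMr //; apply: (@le_trans _ _ (n.+1%:R * gamma n.+1)).
    by rewrite ler_wpM2l // ltW.
  by apply: le_trans (ler_norm _) _; apply: hJ => /=; rewrite leqW.
have {3}<- : Num.sqrt del ^+ 2 = del by rewrite sqr_sqrtr // ltW.
by rewrite le_eqVlt; apply/orP; left; apply/eqP; ring.
Qed.

(** Each nonzero term is O(e^(-s)), and by the decay of order [n >= 1 / s] there are O(e^(-s)) of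
    them. With [s = t1 / 4] the product [y] satisfies [y ^+ 2 = e^(-t1)], so [K * y] is negligible
    against the denominator. *)
Lemma UWT_of_decay (R : realType) (gamma : nat -> R) :
  (forall j, (1 <= j)%N -> 0 <= gamma j <= 1) ->
  (forall n : nat, (fun j : nat => j%:R ^+ n * gamma j) @ \oo --> 0%R) -> UWT gamma.
Proof.
move=> hg hu t1 t2 /andP[t10 t11] _ eta eta0.
have [C0 C00 hC] := cvg0_le _ _ (hu 1%N).
pose C := C0 + 1; pose s := t1 / 4.
have s0 : 0 < s by rewrite divr_gt0.
pose n := (Num.truncn s^-1).+1.
have ns : n%:R^-1 <= s.
  by rewrite invf_ple ?posrE ?ltr0n // ltW // truncnS_gt.
have [Cn Cn0 hCn] := cvg0_le _ _ (hu n).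
pose K := s^-1 * (2 * C) `^ s * (Cn + 1) `^ s.
have K0 : 0 <= K by rewrite !mulr_ge0 ?powR_ge0 ?invr_ge0 ?ltW.
exists ((K / eta) ^+ 2) => e d /andP[e0 e1] d0 hM.
have z0 : 0 < e^-1 by rewrite invr_gt0.
have z1 : 1 <= e^-1 by rewrite invf_ge1 ?ltW.
pose y := e^-1 `^ s * e^-1 `^ s.
have y2 : y ^+ 2 = e `^ (- t1).
  have -> : e `^ (- t1) = e^-1 `^ t1 by rewrite -mulN1r powRrM powR_inv1 ?ltW.
  have -> : t1 = s * 4%:R by rewrite /s divfK.
  by rewrite powRrM powR_mulrn ?powR_ge0 // /y; ring.
have D0 : 0 < e `^ (- t1) + d%:R `^ t2.
  by rewrite ltr_pwDl ?powR_gt0 ?powR_ge0.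
rewrite ger0_norm ?divr_ge0 ?ln_Ngamma_ge0 ?(ltW D0) // ler_pdivrMr //.
suff hsum : ln (Ngamma gamma e d)%:R <= K * y.
  apply: (le_trans hsum).
  have h1 : y ^+ 2 <= e `^ (- t1) + d%:R `^ t2 by rewrite y2 lerDl powR_ge0.
  (* AM-GM: [2 (K / eta) y <= (K / eta)^2 + y^2] *)
  have h2 : (K / eta) * y <= e `^ (- t1) + d%:R `^ t2.
    by have := sqr_ge0 (K / eta - y); rewrite sqrrB; lra.
  have -> : K * y = eta * (K / eta * y) by field; rewrite gt_eqF.
  by rewrite ler_pM2l.
apply: (le_trans (ln_Ngamma_le R gamma C e d hg _ _ e0 d0)).
- by rewrite /C; lra.
- by move=> j _; rewrite /C addrK; have := hC j.+1; rewrite expr1.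
have C2 : 0 < 2 * C by rewrite mulr_gt0 // /C; lra.
pose f (j : nat) := s^-1 * (2 * C) `^ s * e^-1 `^ s.
have f0 j : 0 <= f j by rewrite !mulr_ge0 ?powR_ge0 ?invr_ge0 ?ltW.
apply: (@le_trans _ _ (\sum_(j < d) (if e < gamma j.+1 then f j else 0))).
  apply: ler_sum => j _; case: ifP => // hj.
  have g0 := lt_trans e0 hj.
  have g1 : gamma j.+1 <= 1 by have /andP[] := hg j.+1 isT.
  have q0 : 0 < 2 * C * gamma j.+1 / e by rewrite divr_gt0 // mulr_gt0.
  apply: le_trans (ln_le_powR _ s _ s0 q0) _.
  rewrite /f -[leRHS]mulrA ler_pM2l ?invr_gt0 // -powRM ?(ltW C2) ?(ltW z0) //.
  rewrite ge0_ler_powR ?nnegrE ?(ltW s0) ?(ltW q0) //.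
    by rewrite mulr_ge0 ?(ltW C2) ?(ltW z0).
  by rewrite ler_pM2r // ler_piMr // ltW.
have -> : K * y = (Cn + 1) `^ s * e^-1 `^ s * f 0%N by rewrite /K /y /f; ring.
apply: (sum_cut_le _ f (fun j => e < gamma j.+1)) => //.
  by apply: mulr_ge0 (f0 _); rewrite mulr_ge0 ?powR_ge0.
move=> k hk; rewrite sumr_const card_ord -[leLHS]mulr_natl.
apply: ler_wpM2r; first exact: f0.
(* A base of at least 1 allows the exponent [1 / n] to be raised to [s]; the 1 added to [Cn] ensures
   it. *)
have hCe : 1 <= (Cn + 1) * e^-1 by rewrite -[leLHS]mulr1 ler_pM //; lra.
rewrite -powRM ?(ltW z0) //; last by lra.
apply: (@le_trans _ _ (((Cn + 1) * e^-1) `^ n%:R^-1)); last by rewrite ler_powR.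
have -> : k.+1%:R = (k.+1%:R ^+ n) `^ n%:R^-1 :> R.
  by rewrite -powR_mulrn // -powRrM divff ?powRr1 // pnatr_eq0.
rewrite ge0_ler_powR ?nnegrE ?invr_ge0 ?exprn_ge0 //.
  by rewrite (le_trans _ hCe).
rewrite ler_pdivlMr //; apply: (@le_trans _ _ (k.+1%:R ^+ n * gamma k.+1)).
  by rewrite ler_wpM2l ?exprn_ge0 // ltW.
by apply: (le_trans (hCn k.+1)); rewrite lerDl.
Qed.

Theorem theorem1 (R : realType) (gamma : nat -> R)
  (h1 : gamma 1%N <= 1)
  (hmono : forall j : nat, (1 <= j)%N -> gamma j.+1 <= gamma j)
  (hpos : forall j : nat, (1 <= j)%N -> 0 <= gamma j) :
  (WT gamma <-> (fun j : nat => j%:R * gamma j) @ \oo --> 0%R) /\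
  (UWT gamma <-> forall n : nat, (fun j : nat => j%:R ^+ n * gamma j) @ \oo --> 0%R).
Proof.
have hg j : (1 <= j)%N -> 0 <= gamma j <= 1.
  move=> j1; rewrite hpos //=; case: j j1 => // j _.
  by elim: j => // j IH; exact: le_trans (hmono _ _) IH.
split; split.
- move=> hW; apply: (decay_of_tractable R gamma 1 1 hg hmono).
  + by rewrite ltr01 lexx.
  + by rewrite mulr1.
  move=> eta /hW[M HM]; exists M => e d he d0.
  by rewrite powR_inv1; [exact: HM | case/andP: he => /ltW].
- exact: WT_of_decay.
(* The exponent [1 / (n + 1)] lies in (0,1] even for [n = 0], and [n / (n + 1) <= 1]; [t2 = 1] keeps
   the denominator linear in [d]. *)
- move=> hU n; apply: (decay_of_tractable R gamma n.+1%:R^-1 n hg hmono).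
  + by rewrite invr_gt0 ltr0n invf_le1 ?ltr0n // ler1n.
  + by rewrite ler_pdivrMr ?ltr0n // mul1r ler_nat.
  have := hU n.+1%:R^-1 1; rewrite invr_gt0 ltr0n invf_le1 ?ltr0n // ler1n ltr01 lexx.
  move=> /(_ isT isT) h eta /h[M HM]; exists M => e d he d0.
  by have := HM e d he d0; rewrite powRr1.
- exact: UWT_of_decay.
Qed.
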